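(* Let $3 \leq p \leq q$ be integers. Then $K_{p,q}^+$ is not determined by its spectrum if and only if the quadratic equation $x^2-(q+3)x+(pq+2)=0$ has two integral roots $p''\leq q''$ lying in $[2,\infty)$. Moreover, if $K_{p,q}^+$ is not determined by its spectrum, then $K_{p'',q''}^- \cup (p-2)K_1$ (the disjoint union of $K_{p'',q''}^-$ and $p-2$ isolated vertices) is the unique graph, up to isomorphism, that is cospectral with $K_{p,q}^+$ but not isomorphic to it.
   Context: All graphs are finite and simple. The spectrum of a graph is the multiset of eigenvalues of its adjacency matrix; two graphs are cospectral if they have the same spectrum, and a graph $G$ is determined by its spectrum if every graph cospectral with $G$ is isomorphic to $G$. $K_{p,q}$ denotes the complete bipartite graph with parts of sizes $p$ and $q$, and $K_1$ is a single vertex. For $2 \leq \min\{p,q\}$, $K_{p,q}^-$ denotes the graph obtained from $K_{p,q}$ by deleting one edge, and $K_{p,q}^+$ denotes the graph obtained from $K_{p,q}$ by adding a new vertex $x$ and a new edge $xy$, where $y$ is a vertex in the part of size $\min\{p,q\}$. *)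

(* Defs.v *)
From HB Require Import structures.
From mathcomp Require Import all_boot all_order all_algebra all_field.
Set Implicit Arguments. Unset Strict Implicit. Unset Printing Implicit Defensive.
Import Order.TTheory GRing.Theory Num.Theory.

Definition simple_graph (T : finType) (e : rel T) : Prop :=
  symmetric e /\ irreflexive e.

Definition adjmx (T : finType) (e : rel T) : 'M[algC]_#|T| :=
  (\matrix_(i, j) (e (enum_val i) (enum_val j))%:R)%R.

Definition spectrum (T : finType) (e : rel T) : algC -> nat :=
  fun lam => mup lam (char_poly (adjmx e)).

Definition cospectral (T1 T2 : finType) (e1 : rel T1) (e2 : rel T2) : Prop :=
  forall lam : algC, spectrum e1 lam = spectrum e2 lam.

Definition graph_iso (T1 T2 : finType) (e1 : rel T1) (e2 : rel T2) : Prop :=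
  exists f : T1 -> T2, bijective f /\ forall x y, e2 (f x) (f y) = e1 x y.

Definition DS (T : finType) (e : rel T) : Prop :=
  forall (T' : finType) (e' : rel T'),
    simple_graph e' -> cospectral e e' -> graph_iso e e'.

(* K_{p,q}^+ on 'I_(p+q+1): part A = {0..p-1} (size p = min(p,q) when p <= q),
   part B = {p..p+q-1}, new vertex x = p+q adjacent to y = 0 in part A. *)
Definition Kplus (p q : nat) : rel 'I_(p + q + 1) :=
  fun i j =>
    [|| ((i < p) && (p <= j < p + q)),
        ((j < p) && (p <= i < p + q)),
        ((i == p + q :> nat) && (j == 0 :> nat))
      | ((j == p + q :> nat) && (i == 0 :> nat))].

(* K_{a,b}^- disjoint union with r isolated vertices, on 'I_(a+b+r):
   parts {0..a-1}, {a..a+b-1}, with the edge {0, a} deleted; vertices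
   a+b..a+b+r-1 are isolated. *)
Definition Kminus_iso (a b r : nat) : rel 'I_(a + b + r) :=
  fun i j =>
    (((i < a) && (a <= j < a + b)) || ((j < a) && (a <= i < a + b)))
    && ~~ (((i == 0 :> nat) && (j == a :> nat)) ||
           ((j == 0 :> nat) && (i == a :> nat))).

Arguments Kplus p q i j : clear implicits.
Arguments Kminus_iso a b r i j : clear implicits.

(* Main.v *)
Require Import Defs.
From HB Require Import structures.
From mathcomp Require Import all_boot all_order all_algebra all_field.
From mathcomp Require Import ring zify.
Set Implicit Arguments. Unset Strict Implicit. Unset Printing Implicit Defensive.
Import Order.TTheory GRing.Theory Num.Theory.
Local Open Scope ring_scope.
Local Open Scope sesquilinear_scope.

(** Both K_{p,q}^+ and K_{p'',q''}^- (plus isolated vertices) are blow-ups of the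
    path P_4, with class sizes (1, 1, q, p-1) and (1, p''-1, q''-1, 1). A blow-up
    with class sizes n0, n1, n2, n3 on n vertices has characteristic polynomial
    X^(n-4) (X^4 - m X^2 + D) with m = n0 n1 + n1 n2 + n2 n3 and D = n0 n1 n2 n3,
    because U V and V U have the same nonzero spectrum.

    For K_{p,q}^+ we have 1 - m + D = -q < 0, so exactly one eigenvalue is >= 1,
    exactly one is <= -1, and four are nonzero. By interlacing, a graph with this
    spectrum has no triangle, no induced C_5, no induced 2K_2 and no half graph on
    six vertices. Looking from a vertex of maximal degree, such a graph is bipartite
    with nested neighbourhoods of at most two nonempty kinds, i.e. a blow-up of P_4
    plus isolated vertices. The equations m = p q + 1 and D = (p - 1) q then leave
    only the two families above. *)

(** * Characteristic polynomials of products, and cospectrality as equality of polynomials *)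

(** Multiply the block matrix [B] with rows (X, u) and (v, 1) on the right by a block triangular
    matrix in two ways. Clearing the lower left block leaves X - uv in the corner; clearing the
    upper right block leaves X - vu, at the price of a factor X^k. *)
Lemma char_poly_mulmxC (R : comNzRingType) n k (U : 'M[R]_(n, k))
    (V : 'M[R]_(k, n)) :
  char_poly (U *m V) * 'X^k = char_poly (V *m U) * 'X^n.
Proof.
pose u := map_mx (@polyC R) U; pose v := map_mx (@polyC R) V.
pose B := block_mx ('X%:M : 'M[{poly R}]_n) u v (1%:M : 'M_k).
have detl : char_poly (U *m V) = \det B.
  have -> : \det B = \det (B *m block_mx 1%:M 0 (- v) 1%:M).
    by rewrite det_mulmx det_lblock !det1 !mulr1.
  rewrite mulmx_block !mulmx1 !mul1mx !mulmx0 !add0r addrN mulmxN.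
  by rewrite det_ublock det1 mulr1 /char_poly /char_poly_mx map_mxM.
have detr : char_poly (V *m U) * 'X^n = \det (B *m block_mx 1%:M (- u) 0 'X%:M).
  rewrite mulmx_block !mulmx1 !mul1mx !mulmx0 !addr0 !mulmxN !mul_mx_scalar.
  rewrite mul_scalar_mx addNr det_lblock det_scalar mulrC; congr (_ * \det _).
  by rewrite /char_poly_mx map_mxM addrC.
by rewrite detr det_mulmx -detl det_ublock det1 mul1r det_scalar.
Qed.

(** Both polynomials are monic and split over [algC], so the multiplicities of their roots determine
    them. *)
Lemma char_poly_eqP n1 n2 (A : 'M[algC]_n1) (B : 'M[algC]_n2) :
  (forall x, mup x (char_poly A) = mup x (char_poly B)) <->
  char_poly A = char_poly B.
Proof.
split=> [eqAB|-> //].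
have [rA] := closed_field_poly_normal (char_poly A).
have [rB] := closed_field_poly_normal (char_poly B).
rewrite !(monicP (char_poly_monic _)) !scale1r => defB defA.
rewrite defA defB; apply: perm_big; apply/allP => x _ /=; apply/eqP.
by have := eqAB x; rewrite defA defB !mu_prod_XsubC.
Qed.

(** * Blow-ups of the path on four vertices *)

(* The path 0 - 1 - 2 - 3, with 4 as an isolated vertex. *)
Definition path_rel : rel 'I_5 :=
  fun i j => [&& (i < 4)%N, (j < 4)%N & (j == i.+1 :> nat) || (i == j.+1 :> nat)].

Definition path_blowup (T : finType) (e : rel T) (t : T -> 'I_5) :=
  forall x y, e x y = path_rel (t x) (t y).

Definition class_size (T : finType) (t : T -> 'I_5) (k : nat) : nat :=
  #|[pred x | t x == k :> nat]|.

Lemma det_mx33 (R : comNzRingType) (M : 'M[R]_3) (m : nat -> nat -> R) :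
  (forall i j, M i j = m i j) ->
  \det M = m 0 0 * (m 1 1 * m 2 2 - m 1 2 * m 2 1)
          - m 0 1 * (m 1 0 * m 2 2 - m 1 2 * m 2 0)
          + m 0 2 * (m 1 0 * m 2 1 - m 1 1 * m 2 0).
Proof.
move=> E; rewrite !(expand_det_row _ ord0) !big_ord_recl big_ord0 /cofactor.
rewrite !(expand_det_row _ ord0) !big_ord_recl !big_ord0 /cofactor.
rewrite !det_mx11 !mxE !E /= /bump /=.
ring.
Qed.

(** This is x I - M diag(n0, n1, n2, n3), with M the adjacency matrix of the path: the
    characteristic matrix of the quotient of a blow-up by its classes. *)
Definition path4_rows (R : comNzRingType) (x n0 n1 n2 n3 : R) : seq (seq R) :=
  [:: [:: x; - n1; 0; 0]; [:: - n0; x; - n2; 0];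
      [:: 0; - n1; x; - n3]; [:: 0; 0; - n2; x]].

Lemma det_path4 (R : comNzRingType) (x n0 n1 n2 n3 : R) (M : 'M[R]_4) :
  (forall i j, M i j = nth 0 (nth [::] (path4_rows x n0 n1 n2 n3) i) j) ->
  \det M = x ^+ 4 - (n0 * n1 + n1 * n2 + n2 * n3) * x ^+ 2
            + n0 * n1 * n2 * n3.
Proof.
move=> defM; rewrite (expand_det_row _ ord0) !big_ord_recl big_ord0 !defM /=.
pose m j i k := nth 0 (nth [::] (path4_rows x n0 n1 n2 n3) i.+1) (bump j k).
rewrite !mul0r !addr0 /cofactor.
rewrite (det_mx33 (m := m 0%N)) => [|i k]; last by rewrite !mxE defM.
rewrite (det_mx33 (m := m 1%N)) => [|i k]; last by rewrite !mxE defM.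
rewrite /m /path4_rows /bump /=.
ring.
Qed.

(** The adjacency matrix is S M S^T, where S is the incidence matrix of vertices and classes 0 to 3.
    Moving S to the other end leaves the 4 by 4 matrix M (S^T S), and S^T S is diagonal with the
    class sizes as entries. The factor X^4 on the left avoids the exponent n - 4, which would be
    truncated on small graphs. *)
Lemma char_poly_path_blowup (T : finType) (e : rel T) (t : T -> 'I_5) :
  path_blowup e t -> let n := class_size t in
  char_poly (adjmx e) * 'X^4 =
  ('X^4 - (n 0%N * n 1%N + n 1%N * n 2%N + n 2%N * n 3%N)%:R *: 'X^2
   + (n 0%N * n 1%N * n 2%N * n 3%N)%:R%:P) * 'X^#|T|.
Proof.
move=> et n.
pose S : 'M[algC]_(#|T|, 4) := \matrix_(i, k) (t (enum_val i) == k :> nat)%:R.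
pose M : 'M[algC]_4 :=
  \matrix_(k, l) ((l == k.+1 :> nat) || (k == l.+1 :> nat))%:R.
(* Summing against a row of S picks out one term, or gives 0 for a vertex of the isolated class
   4. *)
have sel (i : 'I_5) (F : 'I_4 -> algC) (G : nat -> algC) :
    (forall k : 'I_4, F k = G k) ->
    \sum_(k < 4) (i == k :> nat)%:R * F k = (i < 4)%N%:R * G i.
  move=> FG; case: ltnP => [i4|i4].
    rewrite (bigD1 (Ordinal i4)) //= eqxx !mul1r FG big1 ?addr0 // => k.
    by rewrite -val_eqE eq_sym /= => /negPf->; rewrite mul0r.
  by rewrite mul0r big1 // => k _; rewrite gtn_eqF ?mul0r // (leq_trans _ i4).
have -> : adjmx e = S *m (M *m S^T).
  apply/matrixP=> i j; rewrite !mxE.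
  pose tj : nat := t (enum_val j).
  pose G k : algC := (tj < 4)%N%:R * ((tj == k.+1) || (k == tj.+1))%:R.
  under eq_bigr do rewrite [S _ _]mxE.
  rewrite (@sel _ _ G) => [|k].
    rewrite et /path_rel /G /tj.
    by do 2!case: (_ < _)%N; rewrite /= ?mul1r ?mul0r ?mulr0.
  rewrite mxE; under eq_bigr do rewrite mulrC [S^T _ _]mxE [S _ _]mxE.
  rewrite (@sel _ _ (fun l => ((l == k.+1) || (k == l.+1 :> nat))%:R)) // => l.
  by rewrite mxE.
rewrite char_poly_mulmxC; congr (_ * _).
have StS k l : (S^T *m S) k l = ((k == l)%:R * (n k)%:R).
  rewrite mxE; under eq_bigr do rewrite !mxE.
  have [<-|neq] := eqVneq k l; last first.
    rewrite mul0r big1 // => i _; case: eqP => [->|]; rewrite ?mul0r //.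
    by rewrite val_eqE (negPf neq) mulr0.
  rewrite mul1r /n /class_size -[in RHS]sum1_card natr_sum.
  rewrite [RHS](reindex_onto enum_val enum_rank) /=; last first.
    by move=> x _; rewrite enum_rankK.
  rewrite [RHS]big_mkcond /=; apply: eq_bigr => i _.
  by rewrite inE enum_valK eqxx andbT; case: eqP => _; rewrite ?mulr1 ?mulr0.
rewrite -mulmxA /char_poly (det_path4 (x := 'X) (n0 := (n 0%N)%:R)
  (n1 := (n 1%N)%:R) (n2 := (n 2%N)%:R) (n3 := (n 3%N)%:R)).
  rewrite -mul_polyC !rmorph_nat !natrD !natrM.
  ring.
move=> i j; rewrite !mxE; under eq_bigr do rewrite StS mxE.
rewrite (bigD1 j) //= eqxx mul1r big1 ?addr0; last first.
  by move=> k /negPf->; rewrite mul0r mulr0.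
case: i => [[|[|[|[|//]]]] ?]; case: j => [[|[|[|[|//]]]] ?] /=;
  by rewrite ?mul0r ?mul1r ?mulr0n ?mulr1n ?polyC0 ?subr0 ?sub0r ?rmorph_nat.
Qed.

Lemma class_size_sum (T : finType) (t : T -> 'I_5) :
  (#|T| = \sum_(k < 5) class_size t k)%N.
Proof.
rewrite -sum1_card (partition_big t xpredT) //=; apply: eq_bigr => k _.
by rewrite sum1_card; apply: eq_card.
Qed.

(** Enumerate each class in both graphs and match the vertices that have the same class and the same
    index. *)
Lemma path_blowup_iso (T1 T2 : finType) (e1 : rel T1) (e2 : rel T2)
    (t1 : T1 -> 'I_5) (t2 : T2 -> 'I_5) :
  path_blowup e1 t1 -> path_blowup e2 t2 ->
  (forall k : 'I_5, class_size t1 k = class_size t2 k) -> graph_iso e1 e2.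
Proof.
move=> et1 et2 eqn.
pose c1 x := enum [pred z | t1 z == t1 x :> nat].
pose c2 x := enum [pred z | t2 z == t1 x :> nat].
have c1in x : x \in c1 x by rewrite mem_enum inE.
have szc x : size (c1 x) = size (c2 x) by rewrite -!cardE; apply: (eqn (t1 x)).
have idx x : (index x (c1 x) < size (c2 x))%N by rewrite -szc index_mem.
(* The default value for [nth]: the class of x has a counterpart in [T2] that is nonempty, because
   an index lies below its size. *)
have y0 (x : T1) : T2 by move: (idx x); case: (c2 x).
pose f x := nth (y0 x) (c2 x) (index x (c1 x)).
have fin x : f x \in c2 x by apply: mem_nth.
have ft x : t2 (f x) = t1 x.
  by have := fin x; rewrite mem_enum inE => /eqP/val_inj.
exists f; split; last by move=> x y; rewrite et2 !ft -et1.
apply: inj_card_bij.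
  move=> x y eqf; have txy : t1 x = t1 y by rewrite -!ft eqf.
  have eqc1 : c1 x = c1 y by rewrite /c1 txy.
  have eqc2 : c2 x = c2 y by rewrite /c2 txy.
  move: eqf; rewrite /f eqc2 -eqc1 (set_nth_default (y0 y)) -?eqc2 //.
  move/eqP; rewrite nth_uniq ?enum_uniq // eqc1; last by rewrite eqc2 idx.
  by move/eqP/(congr1 (nth x (c1 y))); rewrite !nth_index // -eqc1.
suff -> : #|T1| = #|T2| by [].
by rewrite (class_size_sum t1) (class_size_sum t2); apply: eq_bigr => k _.
Qed.

(** * Spectral decomposition, rank and interlacing *)

Lemma char_poly_spectral n (A : 'M[algC]_n) : A \is hermsymmx ->
  char_poly A = \prod_(i < n) ('X - (spectral_diag A 0 i)%:P).
Proof.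
move=> /hermitian_normalmx /orthomx_spectralP {1}->.
apply: (mulIf (monic_neq0 (monicXn algC n))).
rewrite char_poly_mulmxC mulKVmx ?spectral_unit // char_poly_trig ?diag_mx_is_trig //.
by congr (_ * _); apply: eq_bigr => i _; rewrite mxE eqxx mulr1n.
Qed.

Lemma perm_spectral n (A : 'M[algC]_n) (r : seq algC) : A \is hermsymmx ->
  char_poly A = \prod_(z <- r) ('X - z%:P) ->
  perm_eq [seq spectral_diag A 0 i | i : 'I_n] r.
Proof.
move=> hA; rewrite char_poly_spectral // => eqr; apply: prod_XsubC_eq.
by rewrite -eqr big_map big_enum.
Qed.

(** After diagonalisation the matrix is a sum of matrices of rank at most one, one for each nonzero
    eigenvalue. *)
Lemma rank_le_spectral n (A : 'M[algC]_n) (r : seq algC) : A \is hermsymmx ->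
  char_poly A = \prod_(z <- r) ('X - z%:P) ->
  (\rank A <= count [pred z : algC | z != 0%R] r)%N.
Proof.
move=> hA /(perm_spectral hA)/permP <-.
have /hermitian_normalmx /orthomx_spectralP {1}-> := hA.
apply: leq_trans (mxrankM_maxl _ _) _; apply: leq_trans (mxrankM_maxr _ _) _.
rewrite diag_mx_sum_delta count_map -sum1_count big_enum_cond /= [leqRHS]big_mkcond.
elim/big_ind2: _ => [|M a N b leM leN|i _]; first by rewrite mxrank0.
  by apply: leq_trans (mxrank_add _ _) _; rewrite leq_add.
have [->|nz] /= := eqVneq (spectral_diag A 0 i) 0; first by rewrite scale0r mxrank0.
by rewrite (leq_trans (mxrank_scale _ _)) // mxrank_delta.
Qed.

Lemma exists_mulmx_eq0 (F : fieldType) k (y : 'cV[F]_k.+2) :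
  exists2 v : 'rV[F]_k.+2, v != 0 & v *m y = 0.
Proof.
have : kermx y != 0.
  rewrite -mxrank_eq0 mxrank_ker -lt0n subn_gt0.
  by rewrite (leq_ltn_trans (rank_leq_col _)).
by case/rowV0Pn => v /sub_kermxP; exists v.
Qed.

Section Inertia.
Variables (n : nat) (A : 'M[algC]_n) (r : seq algC) (g : algC).
Hypothesis hA : A \is hermsymmx.
Hypothesis rA : char_poly A = \prod_(z <- r) ('X - z%:P).
Let P := spectralmx A.
Let sp := spectral_diag A.

Lemma quad_form_spectral (v : 'rV[algC]_n) : let u := v *m P^t* in
  (v *m (1%:M + g *: A) *m v^t*) 0 0 = \sum_i (1 + g * sp 0 i) * `|u 0 i| ^+ 2.
Proof.
move=> u; have Pu : P \is unitarymx := spectral_unitarymx A.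
have defB : 1%:M + g *: A = P^t* *m diag_mx (\row_i (1 + g * sp 0 i)) *m P.
  have /hermitian_normalmx /orthomx_spectralP {1}-> := hA.
  rewrite -/P -/sp invmx_unitary //.
  have -> : \row_i (1 + g * sp 0 i) = const_mx 1 + g *: sp.
    by apply/rowP=> i; rewrite !mxE.
  rewrite linearD /= linearZ /= diag_const_mx mulmxDr mulmxDl mulmx1.
  rewrite -scalemxAr -scalemxAl; congr (_ + _).
  by rewrite -invmx_unitary // mulVmx ?unitarymx_unit.
have -> : v *m (1%:M + g *: A) *m v^t* = u *m diag_mx (\row_i (1 + g * sp 0 i)) *m u^t*.
  by rewrite defB /u trmx_mul map_mxM trmxCK !mulmxA.
rewrite mxE; apply: eq_bigr => i _.
by clearbody u; rewrite mul_mx_diag !mxE normCK mulrAC mulrC.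
Qed.

(** At most one eigendirection of 1 + g A has a value that is not positive. The row space of [W] has
    dimension at least 2, so it contains a nonzero vector orthogonal to that direction, and there
    the form is positive. *)
Lemma small_index_pos k (W : 'M[algC]_(k.+2, n)) :
  row_free W ->
  (count [pred z : algC | ~~ (0 < 1 + g * z)%R] r <= 1)%N ->
  exists2 c : 'rV_k.+2, c != 0 &
    0 < (c *m W *m (1%:M + g *: A) *m (c *m W)^t*) 0 0.
Proof.
move=> freeW; rewrite -(permP (perm_spectral hA rA)) count_map => cnt.
pose bad := [pred i | ~~ (0 < 1 + g * sp 0 i)].
have bad1 i j : bad i -> bad j -> i = j.
  move=> bi bj; apply/eqP; apply: contraLR cnt => nij; rewrite -ltnNge.
  rewrite -size_filter (@uniq_leq_size _ [:: i; j]) //=; first by rewrite inE nij.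
  by move=> x; rewrite !inE mem_filter mem_enum andbT => /orP[]/eqP->.
have [c c0 cbad] : exists2 c : 'rV[algC]_k.+2, c != 0 &
    forall i, bad i -> (c *m W *m P^t*) 0 i = 0.
  case: (pickP bad) => [i0 bi0|nobad].
    have [c c0 cy] := exists_mulmx_eq0 (col i0 (W *m P^t*)).
    exists c => // i /(bad1 _ _ bi0) <-.
    have := congr1 (fun M : 'M_1 => M 0 0) cy.
    by rewrite colE mulmxA -colE !mulmxA mxE [RHS]mxE.
  exists (delta_mx 0 0); last by move=> i; rewrite nobad.
  apply/eqP=> /matrixP/(_ 0 0)/eqP; by rewrite !mxE oner_eq0.
exists c => //; rewrite quad_form_spectral; set u := c *m W *m P^t*.
have u0 : u != 0.
  rewrite -mxrank_eq0 mxrankMfree ?mxrankMfree ?mxrank_eq0 //.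
  by rewrite row_free_unit unitarymx_unit // trmxC_unitary spectral_unitarymx.
have [i ui] : exists i, u 0 i != 0.
  apply/existsP; apply: contraNT u0; rewrite negb_exists => /forallP u0.
  by apply/eqP/rowP=> i; rewrite [RHS]mxE; apply/eqP/negPn/u0.
have term_ge0 j : 0 <= (1 + g * sp 0 j) * `|u 0 j| ^+ 2.
  have [/cbad->|/negPn h] := boolP (bad j); first by rewrite normr0 expr0n mulr0.
  by rewrite mulr_ge0 ?exprn_ge0 ?normr_ge0 // ltW.
rewrite (bigD1 i) //= ltr_wpDr ?sumr_ge0 //.
have /negPn h : ~~ bad i by apply: contra ui => /cbad->.
by rewrite mulr_gt0 // exprn_gt0 // normr_gt0.
Qed.

End Inertia.

Lemma adjmx_hermsym (T : finType) (e : rel T) :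
  symmetric e -> adjmx e \is hermsymmx.
Proof.
move=> e_sym; apply: realsym_hermsym; last first.
  by apply/mxOverP=> i j; rewrite mxE realn.
apply/is_hermitianmxP; rewrite scale1r; apply/matrixP=> i j.
by rewrite !mxE e_sym.
Qed.

(* Interlacing in the form needed: the rows of [c] span a plane of vectors
   supported on the vertices [s], on which [1 + g A] is diagonal and nonpositive;
   this forces two eigenvalues [z] with [1 + g z <= 0]. *)
Lemma no_nonpos_plane (T : finType) (e : rel T) (r : seq algC) (g : algC)
    (x0 : T) (s : seq T) (c : 'I_2 -> nat -> algC) :
  let q i j := \sum_(a < size s) \sum_(b < size s)
     c i a * c j b * ((a == b)%:R + g * (e (nth x0 s a) (nth x0 s b))%:R) in
  symmetric e -> char_poly (adjmx e) = \prod_(z <- r) ('X - z%:P) ->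
  (count [pred z : algC | ~~ (0 < 1 + g * z)%R] r <= 1)%N ->
  uniq s -> (forall i a, c i a \is Num.real) ->
  q 0 0 <= 0 -> q 1 1 <= 0 -> q 0 1 = 0 -> q 1 0 = 0 ->
  forall a b : 'I_(size s), c 0 a * c 1 b - c 0 b * c 1 a = 0.
Proof.
move=> q e_sym rA cnt us creal q00 q11 q01 q10 a b; apply/eqP/negPn/negP => nz.
pose S : 'M[algC]_(size s, #|T|) :=
  \matrix_(a, i) (i == enum_rank (nth x0 s a))%:R.
pose C := \matrix_(i < 2, a < size s) c i a.
have SM (M : 'M[algC]_#|T|) : S *m M *m S^T =
    \matrix_(a, b) M (enum_rank (nth x0 s a)) (enum_rank (nth x0 s b)).
  apply/matrixP=> i j; rewrite !mxE.
  rewrite (bigD1 (enum_rank (nth x0 s j))) //= big1 ?addr0; last first.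
    by move=> k /negPf nk; rewrite !mxE nk mulr0.
  rewrite !mxE eqxx mulr1 (bigD1 (enum_rank (nth x0 s i))) //= big1 ?addr0.
    by rewrite !mxE eqxx mul1r.
  by move=> k /negPf nk; rewrite !mxE nk mul0r.
have SS : S *m S^T = 1%:M.
  have := SM 1%:M; rewrite mulmx1 => ->; apply/matrixP=> i j.
  by rewrite !mxE (inj_eq enum_rank_inj) nth_uniq.
(* The nonzero minor in columns a and b makes the two rows of [C] independent, by Cramer's rule. *)
have freeC : row_free C.
  apply: inj_row_free => v /rowP vC.
  have eqC (x : 'I_(size s)) : v 0 0 * c 0 x + v 0 1 * c 1 x = 0.
    have := vC x; rewrite !mxE !big_ord_recl big_ord0 addr0 !mxE.
    by rewrite (_ : lift 0 0 = 1) //; apply: val_inj.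
  have v00 : v 0 0 = 0.
    apply: (mulIf nz); rewrite mul0r.
    have -> : v 0 0 * (c 0 a * c 1 b - c 0 b * c 1 a) =
      (v 0 0 * c 0 a + v 0 1 * c 1 a) * c 1 b -
      (v 0 0 * c 0 b + v 0 1 * c 1 b) * c 1 a by ring.
    by rewrite !eqC !mul0r subrr.
  have v01 : v 0 1 = 0.
    apply: (mulIf nz); rewrite mul0r.
    have -> : v 0 1 * (c 0 a * c 1 b - c 0 b * c 1 a) =
      (v 0 0 * c 0 b + v 0 1 * c 1 b) * c 0 a -
      (v 0 0 * c 0 a + v 0 1 * c 1 a) * c 0 b by ring.
    by rewrite !eqC !mul0r subrr.
  apply/rowP=> k; rewrite mxE; case: k => [[|[|//]] lt_k].
    by rewrite -[RHS]v00; congr (v _ _); apply: val_inj.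
  by rewrite -[RHS]v01; congr (v _ _); apply: val_inj.
have freeCS : row_free (C *m S).
  rewrite /row_free mxrankMfree //; apply/row_freeP; by exists S^T.
have [v v0] := small_index_pos (adjmx_hermsym e_sym) rA freeCS cnt.
have CSt : (C *m S)^t* = S^T *m C^T.
  rewrite trmx_mul map_mxM; congr (_ *m _); apply/matrixP=> i j; rewrite !mxE.
    by rewrite rmorph_nat.
  by apply/CrealP.
have -> : v *m (C *m S) *m (1%:M + g *: adjmx e) *m (v *m (C *m S))^t* =
   v *m (C *m (S *m (1%:M + g *: adjmx e) *m S^T) *m C^T) *m v^t*.
  by rewrite [(v *m _)^T]trmx_mul map_mxM CSt !mulmxA.
have -> : C *m (S *m (1%:M + g *: adjmx e) *m S^T) *m C^T =
    \matrix_(i, j) q i j.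
  rewrite SM; apply/matrixP=> i j; rewrite [RHS]mxE /q exchange_big [LHS]mxE /=.
  apply: eq_bigr => x _; rewrite [(_ *m _) _ _]mxE mulr_suml; apply: eq_bigr => y _.
  by rewrite !mxE (inj_eq enum_rank_inj) nth_uniq // !enum_rankK mulrAC.
rewrite !mxE !big_ord_recl big_ord0 !mxE !big_ord_recl !big_ord0 !mxE.
rewrite (_ : lift 0 0 = 1); last exact: val_inj.
(* The form is now |v0|^2 q00 + |v1|^2 q11, which is at most 0 and contradicts positivity. *)
rewrite q01 q10 !mulr0 !addr0 add0r.
rewrite mulrAC -normCK [_ * q 1 1 * _]mulrAC -normCK.
by rewrite le_gtF // -[leRHS]addr0 lerD // mulr_ge0_le0 ?exprn_ge0.
Qed.

(** With integer coefficient lists, the conditions on a concrete small subgraph reduce to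
    computation. *)
Lemma no_int_nonpos_plane (T : finType) (e : rel T) (r : seq algC) (g : int)
    (x0 : T) (s : seq T) (c0 c1 : seq int) (a b : nat) :
  let q (c d : seq int) := \sum_(a < size s) \sum_(b < size s)
     c`_a * d`_b * ((a == b)%:R + g * (e (nth x0 s a) (nth x0 s b))%:R) in
  symmetric e -> char_poly (adjmx e) = \prod_(z <- r) ('X - z%:P) ->
  (count [pred z : algC | ~~ (0 < 1 + g%:~R * z)%R] r <= 1)%N -> uniq s ->
  [/\ q c0 c0 <= 0, q c1 c1 <= 0, q c0 c1 = 0 & q c1 c0 = 0] ->
  [&& (a < size s)%N, (b < size s)%N & c0`_a * c1`_b != c0`_b * c1`_a] -> False.
Proof.
move=> q e_sym rA cnt us [q00 q11 q01 q10] /and3P[lta ltb].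
apply/negP; rewrite negbK -subr_eq0 -(intr_eq0 algC).
pose c (i : 'I_2) k := (if i == 0 then c0`_k else c1`_k)%:~R : algC.
have qE (i j : 'I_2) : \sum_(a < size s) \sum_(b < size s)
     c i a * c j b * ((a == b)%:R + g%:~R * (e (nth x0 s a) (nth x0 s b))%:R)
     = (q (if i == 0 then c0 else c1) (if j == 0 then c0 else c1))%:~R.
  rewrite rmorph_sum; apply: eq_bigr => k _; rewrite rmorph_sum.
  apply: eq_bigr => l _; rewrite !(rmorphM, rmorphD) /= !rmorph_nat /c.
  by case: (i == 0); case: (j == 0).
apply/eqP; rewrite rmorphB !rmorphM.
apply: (@no_nonpos_plane T e r g%:~R x0 s c e_sym rA cnt us)
  (Ordinal lta) (Ordinal ltb).
- by move=> i k; rewrite realz.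
- by rewrite qE lerz0.
- by rewrite qE lerz0.
- by rewrite qE /= q01.
- by rewrite qE /= q10.
Qed.

(** * Forbidden configurations *)

Section Forbidden.
Variables (T : finType) (e : rel T) (r : seq algC).
Hypotheses (e_sym : symmetric e) (e_irr : irreflexive e).
Hypothesis rA : char_poly (adjmx e) = \prod_(z <- r) ('X - z%:P).

Lemma edge_neq x y : e x y -> x != y.
Proof. by apply: contraTneq => ->; rewrite e_irr. Qed.

Lemma separated_neq x y z : e x z -> ~~ e y z -> x != y.
Proof. by move=> xz; apply: contraNneq => <-. Qed.

(** On a triangle 1 + A is the all-ones matrix, which vanishes on the plane of vectors with zero
    sum. *)
Lemma no_triangle x y z :
  (count [pred z : algC | ~~ (0 < 1 + 1%:~R * z)%R] r <= 1)%N ->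
  e x y -> e y z -> e x z -> False.
Proof.
move=> cnt xy yz xz.
apply: (@no_int_nonpos_plane T e r 1 x [:: x; y; z] [:: 1; -1; 0] [:: 0; 1; -1]
  0 2 e_sym rA cnt) => //.
  by rewrite /= !inE !negb_or !edge_neq.
by rewrite !big_ord_recl !big_ord0 /= !(e_irr, xy, yz, xz,
  e_sym y x, e_sym z x, e_sym z y).
Qed.

(** The cycle C_5 has a double eigenvalue below -1. The integer vectors used give the form 1 + A the
    values 0 and -2, and they are orthogonal for it. *)
Lemma no_induced_C5 x1 x2 x3 x4 x5 :
  (count [pred z : algC | ~~ (0 < 1 + 1%:~R * z)%R] r <= 1)%N ->
  [/\ e x1 x2, e x2 x3, e x3 x4, e x4 x5 & e x5 x1] ->
  [/\ ~~ e x1 x3, ~~ e x2 x4, ~~ e x3 x5, ~~ e x4 x1 & ~~ e x5 x2] -> False.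
Proof.
move=> cnt [e12 e23 e34 e45 e51] [n13 n24 n35 n41 n52].
apply: (@no_int_nonpos_plane T e r 1 x1 [:: x1; x2; x3; x4; x5]
  [:: 1; -1; 0; 0; 0] [:: 0; 0; 1; -2; 1] 0 2 e_sym rA cnt) => //.
  have d13 : x1 != x3 by apply: (@separated_neq _ _ x5); rewrite // e_sym.
  have d24 : x2 != x4 by apply: (@separated_neq _ _ x1); rewrite // e_sym.
  have d35 : x3 != x5 by apply: (@separated_neq _ _ x2); rewrite // e_sym.
  have d14 : x1 != x4 by apply: (@separated_neq _ _ x2); rewrite // e_sym.
  have d25 : x2 != x5 by apply: (@separated_neq _ _ x3); rewrite // e_sym.
  have d15 : x1 != x5 by rewrite eq_sym edge_neq.
  by rewrite /= !inE !negb_or d13 d24 d35 d14 d25 d15 !edge_neq.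
rewrite !big_ord_recl !big_ord0 /= !(e_irr, e12, e23, e34, e45, e51,
  e_sym x2 x1, e_sym x3 x2, e_sym x4 x3, e_sym x5 x4, e_sym x1 x5,
  negPf n13, negPf n24, negPf n35, negPf n41, negPf n52,
  e_sym x3 x1, e_sym x4 x2, e_sym x5 x3, e_sym x1 x4, e_sym x2 x5).
by [].
Qed.

(** The indicator vectors of the two edges are isotropic and mutually orthogonal for 1 - A. *)
Lemma no_induced_2K2 x y z w :
  (count [pred z : algC | ~~ (0 < 1 + (-1)%:~R * z)%R] r <= 1)%N ->
  e x y -> e z w -> [/\ ~~ e x z, ~~ e x w, ~~ e y z & ~~ e y w] -> False.
Proof.
move=> cnt xy zw [nxz nxw nyz nyw].
apply: (@no_int_nonpos_plane T e r (-1) x [:: x; y; z; w]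
  [:: 1; 1; 0; 0] [:: 0; 0; 1; 1] 0 2 e_sym rA cnt) => //.
  have dxz : x != z by rewrite eq_sym (separated_neq zw).
  have dxw : x != w by rewrite eq_sym (@separated_neq _ _ z) // e_sym.
  have dyz : y != z by rewrite eq_sym (separated_neq zw).
  have dyw : y != w by rewrite eq_sym (@separated_neq _ _ z) // e_sym.
  by rewrite /= !inE !negb_or dxz dxw dyz dyw !edge_neq.
by rewrite !big_ord_recl !big_ord0 /= !(e_irr, xy, zw, e_sym y x, e_sym w z,
  negPf nxz, negPf nxw, negPf nyz, negPf nyw,
  e_sym z x, e_sym w x, e_sym z y, e_sym w y).
Qed.

(** The six vertices give a nonsingular submatrix of order 6, whatever the adjacencies of x2 y1, x3
    y1 and x3 y2, so the rank would exceed 5. *)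
Lemma no_half_graph x1 x2 x3 y1 y2 y3 :
  (count [pred z : algC | z != 0%R] r <= 5)%N ->
  [/\ e x1 y1, e x2 y2 & e x3 y3] ->
  [/\ ~~ e x1 y2, ~~ e x1 y3 & ~~ e x2 y3] ->
  [/\ ~~ e x1 x2, ~~ e x1 x3 & ~~ e x2 x3] ->
  [/\ ~~ e y1 y2, ~~ e y1 y3 & ~~ e y2 y3] -> False.
Proof.
move=> cnt [e11 e22 e33] [n12 n13 n23] [m12 m13 m23] [l12 l13 l23].
(* These orders of the six rows and columns make the submatrix triangular. *)
pose s1 := [:: x1; x2; x3; y3; y2; y1].
pose s2 := [:: y1; y2; y3; x3; x2; x1].
pose M := \matrix_(i < 6, j < 6)
  adjmx e (enum_rank (nth x1 s1 i)) (enum_rank (nth x1 s2 j)).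
have rkM : (\rank M <= 5)%N.
  apply: leq_trans (leq_trans (rank_le_spectral (adjmx_hermsym e_sym) rA) cnt).
  have -> : M = mxsub (fun i : 'I_6 => enum_rank (nth x1 s1 i))
                      (fun j : 'I_6 => enum_rank (nth x1 s2 j)) (adjmx e) by [].
  rewrite mxsubrc; apply: leq_trans (mxrankS (rowsub_sub _ _)) _.
  rewrite -mxrank_tr trmx_mxsub; apply: leq_trans (mxrankS (rowsub_sub _ _)) _.
  by rewrite mxrank_tr.
suff : (\rank M == 6)%N by move: rkM; case: (\rank M) => [|[|[|[|[|[|]]]]]].
have nonedge := (negPf n12, negPf n13, negPf n23, negPf m12, negPf m13, negPf m23,
  negPf l12, negPf l13, negPf l23).
have trigM : is_trig_mx M.
  apply/is_trig_mxP => -[i lti] [j ltj] /=; rewrite !mxE !enum_rankK /=.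
  move: i j lti ltj => [|[|[|[|[|[|//]]]]]] [|[|[|[|[|[|//]]]]]] //= _ _ _;
   by rewrite ?e_irr // ?nonedge // e_sym ?nonedge.
rewrite -/(row_free M) row_free_unit unitmxE det_trig //.
by rewrite !big_ord_recl big_ord0 !mxE !enum_rankK /= !(e11, e22, e33,
  e_sym y1 x1, e_sym y2 x2, e_sym y3 x3) !mulr1 unitr1.
Qed.

End Forbidden.

(** * From forbidden configurations to a blow-up of the path *)

Section Structure.
Variables (T : finType) (e : rel T).
Hypotheses (e_sym : symmetric e) (e_irr : irreflexive e).
Hypothesis tri : forall x y z, e x y -> e y z -> e x z -> False.
Hypothesis C5 : forall x1 x2 x3 x4 x5,
  [/\ e x1 x2, e x2 x3, e x3 x4, e x4 x5 & e x5 x1] ->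
  [/\ ~~ e x1 x3, ~~ e x2 x4, ~~ e x3 x5, ~~ e x4 x1 & ~~ e x5 x2] -> False.
Hypothesis KK : forall x y z w,
  e x y -> e z w -> [/\ ~~ e x z, ~~ e x w, ~~ e y z & ~~ e y w] -> False.
Hypothesis half : forall x1 x2 x3 y1 y2 y3,
  [/\ e x1 y1, e x2 y2 & e x3 y3] ->
  [/\ ~~ e x1 y2, ~~ e x1 y3 & ~~ e x2 y3] ->
  [/\ ~~ e x1 x2, ~~ e x1 x3 & ~~ e x2 x3] ->
  [/\ ~~ e y1 y2, ~~ e y1 y3 & ~~ e y2 y3] -> False.

Let N x := [set y | e x y].

Section MaxDegree.
Variable u : T.
Hypothesis umax : forall v, (#|N v| <= #|N u|)%N.

(** Two ends in N(u) would close a triangle. If v and w both lie outside, every neighbour of u is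
    adjacent to v or w, as there is no induced 2K_2. Maximality of the degree of u yields a
    neighbour y1 that misses w and a neighbour y2 that misses v, so u, y1, v, w, y2 is an induced
    C_5. *)
Lemma edge_across v w : e v w -> (v \in N u) = ~~ (w \in N u).
Proof.
move=> vw; rewrite !inE; case uv: (e u v); case uw: (e u w) => //=.
  by case: (tri uv vw uw).
have nbr y : e u y -> e y v || e y w.
  move=> uy; apply/negP=> /negP; rewrite negb_or => /andP[yv yw].
  by apply: (KK uy vw); rewrite uv uw.
have missed a b : e a b -> ~~ e u b -> exists2 y, e u y & ~~ e y a.
  move=> ab ub; apply/exists_inP; apply: contraT; rewrite negb_exists_in.
  (* Otherwise N(a) would contain N(u) together with b, exceeding the maximal degree. *)
  move/forall_inP=> all_a; have := umax a; rewrite leqNgt.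
  rewrite (leq_trans _ (subset_leq_card (_ : b |: N u \subset N a))) //.
    by rewrite cardsU1 inE ub.
  apply/subsetP=> y; rewrite !inE => /orP[/eqP-> //|/all_a].
  by rewrite negbK e_sym.
have [||y1 uy1 y1w] := missed w v; rewrite ?uv // 1?e_sym //.
have [||y2 uy2 y2v] := missed v w; rewrite ?uw //.
have y1v : e y1 v by have := nbr _ uy1; rewrite (negPf y1w) orbF.
have y2w : e y2 w by have := nbr _ uy2; rewrite (negPf y2v).
case: (@C5 u y1 v w y2); first by split; rewrite // e_sym.
split; rewrite ?uv // 1?e_sym ?uw //.
by apply/negP=> y12; apply: (tri uy1 _ uy2); rewrite // e_sym.
Qed.

Lemma nbhd_sub x : x \notin N u -> N x \subset N u.
Proof.
move=> xX; apply/subsetP=> y; rewrite inE => /edge_across.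
by rewrite (negPf xX) => /esym/negbT/negPn.
Qed.

Lemma same_side x y : (x \in N u) = (y \in N u) -> ~~ e x y.
Proof. by move=> xy; apply/negP => /edge_across; rewrite xy; case: (_ \in _). Qed.

(** A strict chain of nonempty neighbourhoods N(x), N(y), N(u) would give a half graph: take y1 in
    N(x), y2 in N(y) but not in N(x), and y3 in N(u) but not in N(y). *)
Lemma nbhd_proper x y : x \notin N u -> y \notin N u -> N x != set0 ->
  N y != N u -> N x \subset N y -> N x = N y.
Proof.
move=> xX yX /set0Pn[y1 xy1] yu sxy; apply/eqP; rewrite eqEsubset sxy /=.
apply/subsetP=> y2 yy2; apply/negPn/negP=> xy2.
have /subsetPn[y3 y3u y3y] : ~~ (N u \subset N y).
  by apply: contra yu => suy; rewrite eqEsubset suy nbhd_sub.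
have uu : u \notin N u by rewrite inE e_irr.
have y1u := subsetP (nbhd_sub xX) _ xy1.
have y2u := subsetP (nbhd_sub yX) _ yy2.
have xy3 : ~~ e x y3 by apply: contra y3y => h; apply: (subsetP sxy); rewrite inE.
apply: (@half x y u y1 y2 y3).
- by rewrite !inE in xy1 yy2 y3u; split.
- by rewrite !inE in xy2 y3y; split.
- by split; apply: same_side; rewrite ?(negPf xX) ?(negPf yX) ?(negPf uu).
- by split; apply: same_side; rewrite ?y1u ?y2u ?y3u.
Qed.

(** Incomparable neighbourhoods would give an induced 2K_2; comparable ones are equal by
    [nbhd_proper]. Hence outside N(u) only one nonempty neighbourhood other than N(u) can occur. *)
Lemma nbhd_uniq x y : x \notin N u -> y \notin N u ->
  N x != set0 -> N y != set0 -> N x != N u -> N y != N u -> N x = N y.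
Proof.
move=> xX yX x0 y0 xu yu.
have [sxy|/subsetPn[z xz yz]] := boolP (N x \subset N y); first exact: nbhd_proper.
have [syx|/subsetPn[w yw xw]] := boolP (N y \subset N x).
  exact/esym/nbhd_proper.
have zu := subsetP (nbhd_sub xX) _ xz.
have wu := subsetP (nbhd_sub yX) _ yw.
rewrite !inE in xz yz yw xw.
case: (KK xz yw); split=> //; last 2 first.
- by rewrite e_sym.
- by apply: same_side; rewrite zu wu.
by apply: same_side; rewrite (negPf xX) (negPf yX).
Qed.

Lemma path_blowup_max : exists t, path_blowup e t.
Proof.
pose mid x := [&& x \notin N u, N x != set0 & N x != N u].
have [Z defZ] : exists Z, forall x, mid x -> N x = Z.
  case: (pickP mid) => [x /and3P[xX x0 xu]|none].
    by exists (N x) => y /and3P[yX y0 yu]; apply: nbhd_uniq.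
  by exists set0 => x; rewrite none.
(* With [Z] the exceptional neighbourhood, N(u) splits into classes 0 and 2 along [Z]. Outside,
   class 1 sees all of N(u), class 3 sees [Z], and class 4 sees nothing. *)
pose k v : nat := if v \in N u then (if v \in Z then 2 else 0)%N
  else if N v == N u then 1%N else if N v == set0 then 4 else 3.
have k5 v : (k v < 5)%N by rewrite /k; do 4?case: ifP.
have path_relC i j : path_rel i j = path_rel j i.
  by rewrite /path_rel orbC; case: (i < 4)%N; case: (j < 4)%N.
exists (fun v => Ordinal (k5 v)) => v w.
wlog vw : v w / (w \in N u) ==> (v \in N u).
  move=> IH; have [|] := boolP ((w \in N u) ==> (v \in N u)); first exact: IH.
  rewrite negb_imply => /andP[wu /negPf vu]; rewrite e_sym path_relC; apply: IH.
  by rewrite vu.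
have [eqvw|neqvw] := eqVneq (v \in N u) (w \in N u).
  rewrite (negPf (same_side eqvw)) /path_rel /k /= eqvw.
  by do !case: ifP.
move: vw neqvw; case wu: (w \in N u) => /=; first by case: (v \in N u).
case vu: (v \in N u) => // _ _.
rewrite e_sym -[e w v](in_set (e w)) -/(N w) /path_rel /k /= vu wu.
case: eqP => [->|/eqP wNu]; first by rewrite vu; case: ifP.
case: eqP => [->|/eqP wN0]; first by rewrite inE; case: ifP.
by rewrite (defZ w) /mid ?wu ?wN0 //; case: ifP.
Qed.

End MaxDegree.

Lemma path_blowup_of_forbidden : exists t, path_blowup e t.
Proof.
case: (pickP (@predT T)) => [u0 _|none]; last first.
  by exists (fun=> ord0) => x; have := none x.
apply: (@path_blowup_max [arg max_(u > u0) #|N u|]).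
by case: arg_maxnP => // u _ umax v; apply: umax.
Qed.

End Structure.

(** * Roots of the quartic and the equations for class sizes *)

(** The squares of the roots are the roots of Y^2 - m Y + D, which takes the negative value 1 - m +
    D at 1; one of them is therefore above 1 and the other below. *)
Lemma quartic_roots (m D : nat) : (0 < D)%N -> (D.+1 < m)%N ->
  exists a b : algC, [/\ 0 < b, b < 1, 1 < a &
    'X^4 - m%:R *: 'X^2 + D%:R%:P = \prod_(z <- [:: a; - a; b; - b]) ('X - z%:P)].
Proof.
move=> D0 Dm.
pose d : algC := sqrtC (m ^ 2 - 4 * D)%:R.
have d2 : d ^+ 2 = m%:R ^+ 2 - 4 * D%:R.
  by rewrite sqrtCK natrB ?natrX ?natrM //; nia.
have d0 : 0 <= d by rewrite sqrtC_ge0 ler0n.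
pose al := (m%:R + d) / 2; pose be := (m%:R - d) / 2.
have sumE : al + be = m%:R by rewrite /al /be; field.
have prodE : al * be = D%:R.
  rewrite /al /be; transitivity ((m%:R ^+ 2 - d ^+ 2) / 4); first by field.
  by rewrite d2; field.
have al1 : 1 < al.
  rewrite /al ltr_pdivlMr ?mul1r // ltr_wpDr // ltr_nat; lia.
have al0 : 0 < al by apply: lt_trans al1.
have be0 : 0 < be by rewrite -(pmulr_rgt0 _ al0) prodE ltr0n.
have be1 : be < 1.
  rewrite -subr_gt0 -(pmulr_rgt0 (x := al - 1)) ?subr_gt0 //.
  have -> : (al - 1) * (1 - be) = (al + be) - (al * be + 1) by ring.
  by rewrite sumE prodE subr_gt0 natr1 ltr_nat.
have a2 := sqrtCK al; have b2 := sqrtCK be.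
exists (sqrtC al), (sqrtC be); split.
- by rewrite sqrtC_gt0.
- by rewrite -(@ltr_pXn2r _ 2) ?nnegrE ?sqrtC_ge0 ?ltW // b2 expr1n.
- by rewrite -(@ltr_pXn2r _ 2) ?nnegrE ?sqrtC_ge0 ?ltW // a2 expr1n.
move: (sqrtC al) (sqrtC be) a2 b2 => a b a2 b2.
rewrite !big_cons big_nil -mul_polyC -sumE -prodE -a2 -b2.
rewrite !(rmorphM, rmorphD, rmorphN, rmorphXn) /=.
ring.
Qed.

(** The sum exceeds the product by q + 1, hence by at least 4. Unless an end class and its
    neighbour, or both end classes, have size 1, the excess is at most 2. *)
Lemma path_class_sizes (P q n0 n1 n2 n3 : nat) :
  (2 <= P)%N -> (3 <= q)%N ->
  (n0 * n1 + n1 * n2 + n2 * n3 = P * q + q + 1)%N ->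
  (n0 * n1 * n2 * n3 = P * q)%N ->
  [\/ [/\ n0 = 1, n3 = 1 & n1 + n2 = q + 1]%N,
      [/\ n0 = 1, n1 = 1, n2 = q & n3 = P]%N |
      [/\ n3 = 1, n2 = 1, n1 = q & n0 = P]%N].
Proof.
move=> P2 q3 sumE prodE.
have [n0p n1p n2p n3p] : [/\ 0 < n0, 0 < n1, 0 < n2 & 0 < n3]%N.
  have : (0 < n0 * n1 * n2 * n3)%N by rewrite prodE; nia.
  by rewrite !muln_gt0 => /andP[/andP[/andP[]]].
have cancelq c : (q * c = P * q)%N -> c = P.
  by rewrite mulnC => /eqP; rewrite eqn_pmul2r ?(leq_trans _ q3) // => /eqP.
have bad1 a b c : (1 < a -> 0 < b -> 1 < c -> a + a * b + b * c <= a * b * c + 2)%N.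
  case: a b c => [|[|i]] [|k] [|[|j]] // _ _ _.
  nia.
case: (n0 =P 1%N) => [e0|/eqP ne0]; case: (n3 =P 1%N) => [e3|/eqP ne3].
- by constructor 1; split=> //; nia.
- case: (n1 =P 1%N) => [e1|/eqP ne1].
    have e2 : n2 = q by nia.
    by constructor 2; split=> //; apply: cancelq; nia.
  have := @bad1 n1 n2 n3; rewrite e0 in sumE prodE; nia.
- case: (n2 =P 1%N) => [e2|/eqP ne2].
    have e1 : n1 = q by nia.
    by constructor 3; split=> //; apply: cancelq; nia.
  have := @bad1 n2 n1 n0; rewrite e3 in sumE prodE; nia.
(* With both end classes of size at least 2, n1 n2 <= (n0 n1 - 1)(n2 n3 - 1) bounds the excess by
   1. *)
have h1 : (n1 <= n0 * n1 - 1)%N by nia.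
have h2 : (n2 <= n2 * n3 - 1)%N by nia.
have := leq_mul h1 h2; nia.
Qed.

(** * Class sizes of the two families *)

Lemma card_ord_interval (N a b : nat) :
  #|[pred i : 'I_N | a <= i < b]%N| = (minn b N - a)%N.
Proof.
rewrite -sum1_card big_mkcond /=; elim: N => [|N IH].
  by rewrite big_ord0 minn0.
by rewrite big_ord_recr /= IH !inE /=; case: ifP; lia.
Qed.

Definition Kplus_class (p q i : nat) : nat :=
  if (i < p)%N then (if i == 0%N then 1 else 3) else if (i < p + q)%N then 2 else 0.

(** The ends of the deleted edge form the two end classes of the path. *)
Definition Kminus_class (a b i : nat) : nat :=
  if (i < a)%N then (if i == 0%N then 3 else 1)
  else if (i < a + b)%N then (if i == a then 0 else 2) else 4.

Definition ord_class (N : nat) (f : nat -> nat) : 'I_N -> 'I_5 :=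
  fun i => inord (f i).

Lemma Kplus_class_lt p q i : (Kplus_class p q i < 5)%N.
Proof. by rewrite /Kplus_class; do !case: ifP. Qed.

Lemma Kminus_class_lt a b i : (Kminus_class a b i < 5)%N.
Proof. by rewrite /Kminus_class; do !case: ifP. Qed.

Lemma Kplus_blowup p q : (0 < p)%N ->
  path_blowup (Kplus p q) (ord_class (Kplus_class p q)).
Proof.
move=> p0 [i lti] [j ltj]; rewrite /path_rel /ord_class !inordK ?Kplus_class_lt //.
rewrite /Kplus /Kplus_class /=.
do !case: ifPn => ?; lia.
Qed.

Lemma Kminus_blowup a b r :
  path_blowup (Kminus_iso a b r) (ord_class (Kminus_class a b)).
Proof.
move=> [i lti] [j ltj]; rewrite /path_rel /ord_class !inordK ?Kminus_class_lt //.
rewrite /Kminus_iso /Kminus_class /=.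
do !case: ifPn => ?; lia.
Qed.

(** In both labellings every class is an interval of vertex numbers, possibly empty. *)
Lemma ord_class_size N f k a b : (forall i, f i < 5)%N ->
  (forall i, i < N -> (f i == k) = (a <= i < b))%N ->
  class_size (ord_class f : 'I_N -> _) k = (minn b N - a)%N.
Proof.
move=> f5 fk; rewrite -card_ord_interval; apply: eq_card => i.
by rewrite !inE /ord_class inordK // fk.
Qed.

Lemma Kplus_class_size p q (k : nat) : (0 < p)%N -> (k < 5)%N ->
  class_size (ord_class (Kplus_class p q) : 'I_(p + q + 1) -> _) k =
  nth 0%N [:: 1; 1; q; p - 1; 0]%N k.
Proof.
move=> p0; have lt5 i := Kplus_class_lt p q i.
case: k => [|[|[|[|[|//]]]]] _ /=.
- rewrite (ord_class_size (a := p + q) (b := p + q + 1)) => // [|i ltN]; first lia.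
  by rewrite /Kplus_class; do !case: ifPn => ?; lia.
- rewrite (ord_class_size (a := 0) (b := 1)) => // [|i ltN]; first lia.
  by rewrite /Kplus_class; do !case: ifPn => ?; lia.
- rewrite (ord_class_size (a := p) (b := p + q)) => // [|i ltN]; first lia.
  by rewrite /Kplus_class; do !case: ifPn => ?; lia.
- rewrite (ord_class_size (a := 1) (b := p)) => // [|i ltN]; first lia.
  by rewrite /Kplus_class; do !case: ifPn => ?; lia.
- rewrite (ord_class_size (a := 0) (b := 0)) => // [|i ltN]; first lia.
  by rewrite /Kplus_class; do !case: ifPn => ?; lia.
Qed.

Lemma Kminus_class_size a b r (k : nat) : (0 < a)%N -> (0 < b)%N -> (k < 5)%N ->
  class_size (ord_class (Kminus_class a b) : 'I_(a + b + r) -> _) k =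
  nth 0%N [:: 1; a - 1; b - 1; 1; r]%N k.
Proof.
move=> a0 b0; have lt5 i := Kminus_class_lt a b i.
case: k => [|[|[|[|[|//]]]]] _ /=.
- rewrite (ord_class_size (a := a) (b := a + 1)) => // [|i ltN]; first lia.
  by rewrite /Kminus_class; do !case: ifPn => ?; lia.
- rewrite (ord_class_size (a := 1) (b := a)) => // [|i ltN]; first lia.
  by rewrite /Kminus_class; do !case: ifPn => ?; lia.
- rewrite (ord_class_size (a := a + 1) (b := a + b)) => // [|i ltN]; first lia.
  by rewrite /Kminus_class; do !case: ifPn => ?; lia.
- rewrite (ord_class_size (a := 0) (b := 1)) => // [|i ltN]; first lia.
  by rewrite /Kminus_class; do !case: ifPn => ?; lia.
- rewrite (ord_class_size (a := a + b) (b := a + b + r)) => // [|i ltN]; first lia.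
  by rewrite /Kminus_class; do !case: ifPn => ?; lia.
Qed.

(** Reversing the path is what allows the inner classes to be ordered by size and the mirrored
    solution to be recognised. *)
Lemma path_blowup_rev (T : finType) (e : rel T) t : path_blowup e t ->
  exists2 t', path_blowup e t' & forall k : nat, (k < 5)%N ->
    class_size t' k = class_size t (if (k < 4)%N then 3 - k else 4)%N.
Proof.
move=> et; pose rv (k : nat) := (if (k < 4)%N then 3 - k else 4)%N.
have rv5 k : (rv k < 5)%N by rewrite /rv; case: ifP; lia.
exists (fun x => inord (rv (t x))) => [x y|k k5].
  rewrite et /path_rel !inordK //; case: (t x) (t y) => [i ?] [j ?] /=.
  by rewrite /rv; case: ifPn; case: ifPn; lia.
apply: eq_card => x; rewrite !inE inordK //.
by have := ltn_ord (t x); rewrite /rv; do 2!case: ifPn; lia.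
Qed.

(** * Classification of the cospectral graphs *)

Definition quartic (m D : nat) : {poly algC} := 'X^4 - m%:R *: 'X^2 + D%:R%:P.

Lemma quartic_inj m D m' D' : quartic m D = quartic m' D' -> m = m' /\ D = D'.
Proof.
move=> eqF; have := (congr1 (fun f : {poly algC} => f`_0) eqF,
                     congr1 (fun f : {poly algC} => f`_2) eqF).
rewrite !(coefD, coefN, coefZ, coefXn, coefC) /= !mulr0 !mulr1 subr0 !add0r !addr0.
by case=> /eqP; rewrite eqr_nat => /eqP-> /oppr_inj/eqP; rewrite eqr_nat => /eqP->.
Qed.

Lemma cospectral_char_poly (T1 T2 : finType) (e1 : rel T1) (e2 : rel T2) :
  cospectral e1 e2 <-> char_poly (adjmx e1) = char_poly (adjmx e2).
Proof. exact: char_poly_eqP. Qed.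

Lemma cospectral_card (T1 T2 : finType) (e1 : rel T1) (e2 : rel T2) :
  cospectral e1 e2 -> #|T1| = #|T2|.
Proof.
move/cospectral_char_poly/(congr1 (fun f : {poly algC} => size f)).
by rewrite !size_char_poly => -[].
Qed.

Lemma char_poly_Kplus p q : (0 < p)%N ->
  char_poly (adjmx (Kplus p q)) * 'X^4 =
  quartic (p * q + 1) ((p - 1) * q) * 'X^(p + q + 1).
Proof.
move=> p0; rewrite (char_poly_path_blowup (Kplus_blowup (q := q) p0)) card_ord.
rewrite !Kplus_class_size //=; congr (_ * _); rewrite /quartic.
by congr (_ - _%:R *: _ + _%:R%:P); nia.
Qed.

Lemma char_poly_Kminus a b r : (0 < a)%N -> (0 < b)%N ->
  char_poly (adjmx (Kminus_iso a b r)) * 'X^4 =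
  quartic (a * b - 1) ((a - 1) * (b - 1)) * 'X^(a + b + r).
Proof.
move=> a0 b0; rewrite (char_poly_path_blowup (@Kminus_blowup a b r)) card_ord.
rewrite !Kminus_class_size //=; congr (_ * _); rewrite /quartic.
by congr (_ - _%:R *: _ + _%:R%:P); nia.
Qed.

Lemma path_blowup_of_quartic (T : finType) (e : rel T) (m D : nat) :
  (0 < D)%N -> (D.+1 < m)%N -> (4 <= #|T|)%N -> simple_graph e ->
  char_poly (adjmx e) * 'X^4 = quartic m D * 'X^#|T| ->
  exists t, path_blowup e t.
Proof.
move=> D0 Dm T4 [e_sym e_irr] eqF.
have [a [b [b0 b1 a1 rootsE]]] := quartic_roots D0 Dm.
pose r := [:: a; - a; b; - b] ++ nseq (#|T| - 4) 0.
have rA : char_poly (adjmx e) = \prod_(z <- r) ('X - z%:P).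
  apply: (mulIf (monic_neq0 (monicXn algC 4))).
  rewrite eqF /quartic rootsE /r big_cat /= -mulrA; congr (_ * _).
  by rewrite big_nseq subr0 -Monoid.iteropE -exprD subnK.
have a0 : 0 < a := lt_trans ltr01 a1.
(* Only z = -a violates 0 < 1 + z; below, only z = a violates 0 < 1 - z. *)
have cntN : (count [pred z : algC | ~~ (0 < 1 + 1%:~R * z)%R] r <= 1)%N.
  rewrite /r count_cat count_nseq /= !mulr1z !mul1r addr0 ltr01.
  by rewrite !subr_gt0 b1 (lt_gtF a1) !addr_gt0.
have cntP : (count [pred z : algC | ~~ (0 < 1 + (-1)%:~R * z)%R] r <= 1)%N.
  rewrite /r count_cat count_nseq /= !mulrN1z !mulN1r !opprK oppr0 addr0 ltr01.
  by rewrite !subr_gt0 b1 (lt_gtF a1) !addr_gt0.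
have cnt0 : (count [pred z : algC | z != 0%R] r <= 5)%N.
  by rewrite /r count_cat count_nseq /= eqxx mul0n; do !case: (_ != _).
apply: path_blowup_of_forbidden => //.
- by move=> x y z; apply: (no_triangle e_sym e_irr rA cntN).
- by move=> x1 x2 x3 x4 x5; apply: (no_induced_C5 e_sym e_irr rA cntN).
- by move=> x y z w; apply: (no_induced_2K2 e_sym e_irr rA cntP).
- by move=> x1 x2 x3 y1 y2 y3; apply: (no_half_graph e_sym e_irr rA cnt0).
Qed.

Lemma cospectral_Kplus_classification (p q : nat) (T : finType) (e : rel T) :
  (3 <= p)%N -> (p <= q)%N -> simple_graph e -> cospectral (Kplus p q) e ->
  graph_iso (Kplus p q) e \/
  exists p2 q2 : nat, [/\ (2 <= p2)%N, (p2 <= q2)%N, (p2 + q2 = q + 3)%N,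
    (p2 * q2 = p * q + 2)%N & graph_iso e (Kminus_iso p2 q2 (p - 2))].
Proof.
move=> p3 pq simple_e cosp.
have p0 : (0 < p)%N by apply: leq_trans p3.
have cardT := cospectral_card cosp; rewrite card_ord in cardT.
have eqF : char_poly (adjmx e) * 'X^4 =
    quartic (p * q + 1) ((p - 1) * q) * 'X^#|T|.
  by rewrite -((cospectral_char_poly _ _).1 cosp) char_poly_Kplus // cardT.
have [||| t et] := path_blowup_of_quartic _ _ _ simple_e eqF; rewrite -?cardT; try nia.
have := eqF; rewrite (char_poly_path_blowup et).
move/(mulIf (monic_neq0 (monicXn algC _)))/quartic_inj => [mE DE].
have := class_size_sum t.
rewrite -cardT !big_ord_recl big_ord0 /= /bump /= !add1n => sumE.
have [t' et' size_t'] := path_blowup_rev et.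
have p1 : (2 <= p - 1)%N by lia.
have pqE : (p * q + 1 = (p - 1) * q + q + 1)%N by nia.
rewrite pqE in mE.
have [[n0 n3 n12]|[n0 n1 n2 n3]|[n3 n2 n1 n0]] :=
  path_class_sizes p1 (leq_trans p3 pq) mE DE.
- right; rewrite n0 n3 mul1n muln1 in DE.
  have sum12 : ((class_size t 1).+1 + (class_size t 2).+1 = q + 3)%N by lia.
  have prod12 : ((class_size t 1).+1 * (class_size t 2).+1 = p * q + 2)%N.
    by rewrite mulSn mulnS DE; lia.
  have [n1p n2p] : (0 < class_size t 1)%N /\ (0 < class_size t 2)%N.
    have : (0 < class_size t 1 * class_size t 2)%N.
      by rewrite DE muln_gt0; apply/andP; split; lia.
    by rewrite muln_gt0 => /andP.
  (* The other four classes account for q + 3 of the p + q + 1 vertices. *)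
  have n4 : class_size t 4 = (p - 2)%N by lia.
  have [le12|/ltnW le21] := leqP (class_size t 1) (class_size t 2).
    exists (class_size t 1).+1, (class_size t 2).+1; split=> //.
    apply: (path_blowup_iso et (@Kminus_blowup _ _ _)) => k.
    rewrite Kminus_class_size //.
    by case: k => [[|[|[|[|[|//]]]]] ?] /=; rewrite ?subSS ?subn0.
  exists (class_size t 2).+1, (class_size t 1).+1.
  split=> //; [by rewrite addnC | by rewrite mulnC |].
  apply: (path_blowup_iso et' (@Kminus_blowup _ _ _)) => k.
  rewrite Kminus_class_size // size_t' //.
  by case: k => [[|[|[|[|[|//]]]]] ?] /=; rewrite ?subSS ?subn0.
- have n4 : class_size t 4 = 0%N by lia.
  left; apply: (path_blowup_iso (Kplus_blowup (q := q) p0) et) => k.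
  rewrite Kplus_class_size //.
  by case: k => [[|[|[|[|[|//]]]]] ?] /=; rewrite ?n0 ?n1 ?n2 ?n3 ?n4.
- have n4 : class_size t 4 = 0%N by lia.
  left; apply: (path_blowup_iso (Kplus_blowup (q := q) p0) et') => k.
  rewrite Kplus_class_size // size_t' //.
  by case: k => [[|[|[|[|[|//]]]]] ?] /=; rewrite ?subSS ?subn0 ?n0 ?n1 ?n2 ?n3 ?n4.
Qed.

(** The quartics agree, since p2 q2 - 1 = p q + 1 and (p2 - 1)(q2 - 1) = p2 q2 - (p2 + q2) + 1 = (p
    - 1) q. *)
Lemma cospectral_Kplus_Kminus (p q p2 q2 : nat) :
  (3 <= p)%N -> (2 <= p2)%N -> (2 <= q2)%N ->
  (p2 + q2 = q + 3)%N -> (p2 * q2 = p * q + 2)%N ->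
  cospectral (Kplus p q) (Kminus_iso p2 q2 (p - 2)).
Proof.
move=> p3 p22 q22 sumE prodE; apply/cospectral_char_poly.
apply: (mulIf (monic_neq0 (monicXn algC 4))).
rewrite char_poly_Kplus ?char_poly_Kminus; try lia.
by congr (quartic _ _ * 'X^_); nia.
Qed.

(** Vertex a + b is isolated on the right, while every vertex on the left has a neighbour. *)
Lemma Kplus_not_iso_Kminus (p q a b r : nat) :
  (0 < p)%N -> (0 < q)%N -> (0 < r)%N ->
  ~ graph_iso (Kplus p q) (Kminus_iso a b r).
Proof.
move=> p0 q0 r0 [f [[g gf fg] fe]].
have lt_ab : (a + b < a + b + r)%N by lia.
pose v := g (Ordinal lt_ab).
have [w] : exists w, Kplus p q v w.
  have lt_0 : (0 < p + q + 1)%N by lia.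
  have lt_p : (p < p + q + 1)%N by lia.
  have [lt_vp|le_pv] := ltnP v p.
    by exists (Ordinal lt_p); rewrite /Kplus /=; lia.
  exists (Ordinal lt_0); rewrite /Kplus /=; have := ltn_ord v; lia.
by rewrite -fe fg /Kminus_iso /=; have := ltn_ord (f w); lia.
Qed.

Lemma quadratic_factorP (s c a b : nat) :
  ('X^2 - s%:R *: 'X + c%:R%:P : {poly int}) = ('X - (a%:R)%:P) * ('X - (b%:R)%:P)
  <-> (a + b = s)%N /\ (a * b = c)%N.
Proof.
have -> : ('X - (a%:R)%:P) * ('X - (b%:R)%:P) =
    'X^2 - (a + b)%:R *: 'X + (a * b)%:R%:P :> {poly int}.
  by rewrite -mul_polyC natrD natrM !(rmorphD, rmorphM) /=; ring.
split=> [eqF|[-> ->] //].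
have := (congr1 (fun f : {poly int} => f`_0) eqF,
         congr1 (fun f : {poly int} => f`_1) eqF).
rewrite !(coefD, coefN, coefZ, coefXn, coefX, coefC) /= !mulr0 !mulr1 subr0 !add0r !addr0.
by case=> /eqP; rewrite eqr_nat => /eqP-> /oppr_inj/eqP; rewrite eqr_nat => /eqP->.
Qed.

Theorem theorem4p1 (p q : nat) :
  (3 <= p)%N -> (p <= q)%N ->
  (~ DS (Kplus p q) <->
     exists p2 q2 : nat,
       [/\ (2 <= p2)%N, (p2 <= q2)%N &
         ('X^2 - (q + 3)%:R *: 'X + ((p * q + 2)%:R)%:P : {poly int})
           = ('X - (p2%:R)%:P) * ('X - (q2%:R)%:P)]) /\
  (~ DS (Kplus p q) ->
     forall p2 q2 : nat,
       (2 <= p2)%N -> (p2 <= q2)%N ->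
       ('X^2 - (q + 3)%:R *: 'X + ((p * q + 2)%:R)%:P : {poly int})
           = ('X - (p2%:R)%:P) * ('X - (q2%:R)%:P) ->
       [/\ cospectral (Kplus p q) (Kminus_iso p2 q2 (p - 2)),
           ~ graph_iso (Kplus p q) (Kminus_iso p2 q2 (p - 2)) &
           forall (T : finType) (e : rel T),
             simple_graph e -> cospectral (Kplus p q) e ->
             ~ graph_iso (Kplus p q) e ->
             graph_iso e (Kminus_iso p2 q2 (p - 2))]).
Proof.
move=> p3 pq.
have not_iso a b : ~ graph_iso (Kplus p q) (Kminus_iso a b (p - 2)).
  by apply: Kplus_not_iso_Kminus; lia.
split; [split|].
- move=> notDS.
  (* The negation of [DS] provides no explicit graph, so the existence of roots is first decided by
     a finite search; the smaller root is below q + 4 because the roots sum to q + 3. *)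
  have [/existsP[a /and3P[a2 le_a /eqP prodE]]|none] :=
    boolP [exists a : 'I_(q + 4),
      [&& 2 <= a, a <= q + 3 - a & a * (q + 3 - a) == p * q + 2]]%N.
    exists a, (q + 3 - a)%N; split=> //; apply/quadratic_factorP; split=> //.
    by have := ltn_ord a; lia.
  case: notDS => T e simple_e cosp.
  have [//|[a [b [a2 le_ab sumE prodE _]]]] :=
    cospectral_Kplus_classification p3 pq simple_e cosp.
  case/negP: none; apply/existsP; have lt_a : (a < q + 4)%N by lia.
  exists (Ordinal lt_a); have bE : (q + 3 - a)%N = b by lia.
  by rewrite /= bE a2 le_ab prodE eqxx.
- case=> a [b [a2 le_ab /quadratic_factorP[sumE prodE]]] allDS.
  apply: (not_iso a b); apply: allDS; last first.
    by apply: cospectral_Kplus_Kminus => //; lia.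
  split=> [i j|i]; rewrite !Kminus_blowup /path_rel; last by rewrite ltn_eqF ?andbF.
  by rewrite orbC andbCA.
- move=> _ a b a2 le_ab /quadratic_factorP[sumE prodE]; split=> //.
    by apply: cospectral_Kplus_Kminus => //; lia.
  move=> T e simple_e cosp noniso.
  have [//|[c [d [c2 le_cd sum_cd prod_cd]]]] :=
    cospectral_Kplus_classification p3 pq simple_e cosp.
  (* An ordered pair is determined by its sum and product. *)
  have -> : c = a by nia.
  by have -> : d = b by nia.
Qed.
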